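(* Assume unit variances $\sigma_i=1$ for $i=1,\dots,p$, the linear model $X_a=X^a\theta^0_a+\epsilon_a$ with Gaussian noise as described, and that $S_0$ satisfies the $\Delta$-compatibility condition for some $\Delta>0$ with constant $\phi_{0,a}>0$. Let $$\lambda=\frac{4(t+\log p)}n,\qquad\mu=\frac4B\sqrt{\frac2n(t+\log p)},\qquad t\ge2n\Big(3+\frac{14}{\Delta}\Big)^2.$$ Then with probability at least $1-e^{-t}$, $$\frac1n\|X^a(\hat\theta^{\lambda,\mu}_a-\theta^0_a)\|_2^2+(\lambda-3B\mu)\|\hat\theta^{\lambda,\mu}_a-\theta^0_a\|_1\le\frac{s_0(2\lambda+B\mu)^2}{\phi_{0,a}^2}.$$
   Context: $X=(X_1,\dots,X_p)\sim N(0,\Sigma)$, $n$ i.i.d. observations. Fix a node $a$. $X_a\in\mathbb{R}^n$ is the observed $a$-th variable, $X^a$ the $n\times p$ observation matrix with $a$-th column set to zero, $\theta^0_a$ the true coefficient vector, and $\epsilon_a$ has i.i.d. $N(0,\sigma_{aa}-\Sigma_{ab}\Sigma_{bb}^{-1}\Sigma_{ab}')$ entries independent of $X^a$ (block notation with coordinate $a$ first). $S_0=\{j:\theta^0_{a,j}\neq0\}$, $s_0=|S_0|$. For $S\subseteq\{1,\dots,p\}$, $\theta_S$ has entries $\theta_j\mathbf{1}\{j\in S\}$ and $\theta_{S^c}$ entries $\theta_j\mathbf{1}\{j\notin S\}$. The local difference matrix $D^a$: from a known local neighborhood graph with edge set $E_{\rm local}$, $D$ has a row $e_i-e_j$ per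 edge $\{i,j\}$, $i<j$; $D^a$ keeps rows with $a$-th entry $0$. $B$ bounds the number of nonzero entries in any column of $D^a$. $\hat\theta^{\lambda,\mu}_a=\operatorname{argmin}_{\theta_a}\big[\frac1n\|X_a-X^a\theta_a\|_2^2+\lambda\|\theta_a\|_1+\mu\|D^a\theta_a\|_1\big]$. $\Delta$-compatibility condition: for all $\theta\in\mathbb{R}^p$ with $\|\theta_{S_0^c}\|_1\le(3+\Delta)\|\theta_{S_0}\|_1$ one has $\|\theta_{S_0}\|_1^2\le\frac{s_0\,\theta'X^{a\prime}X^a\theta}{n\phi_{0,a}^2}$. *)

(* Defs.v *)
From HB Require Import structures.
From mathcomp Require Import all_boot all_order all_algebra.
From mathcomp Require Import all_classical all_reals all_analysis.
Set Implicit Arguments. Unset Strict Implicit. Unset Printing Implicit Defensive.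
Import Order.TTheory GRing.Theory Num.Theory.
Local Open Scope classical_set_scope.
Local Open Scope ring_scope.

Section Defs.
Variables (R : realType) (n p : nat).

Definition Xminus (X : 'M[R]_(n, p)) (a : 'I_p) : 'M[R]_(n, p) :=
  \matrix_(i, j) (if j == a then 0 else X i j).

Definition Xmul (X : 'M[R]_(n, p)) (a : 'I_p) (theta : 'I_p -> R) (i : 'I_n) : R :=
  \sum_(j < p) Xminus X a i j * theta j.

Definition l1norm (theta : 'I_p -> R) : R := \sum_(j < p) `|theta j|.

Definition restr (S : {set 'I_p}) (theta : 'I_p -> R) : 'I_p -> R :=
  fun j => if j \in S then theta j else 0.
Definition restrC (S : {set 'I_p}) (theta : 'I_p -> R) : 'I_p -> R :=
  fun j => if j \in S then 0 else theta j.

(* rows of D^a : edges {i,j} (stored as (i,j) with i<j) of E_local avoiding a *)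
Definition Da_edges (Elocal : {set 'I_p * 'I_p}) (a : 'I_p) : {set 'I_p * 'I_p} :=
  [set e in Elocal | (e.1 != a) && (e.2 != a)].

(* ||D^a theta||_1 : row e_i - e_j contributes |theta_i - theta_j| *)
Definition Dnorm (Elocal : {set 'I_p * 'I_p}) (a : 'I_p) (theta : 'I_p -> R) : R :=
  \sum_(e in Da_edges Elocal a) `|theta e.1 - theta e.2|.

(* number of nonzero entries of column k of D^a *)
Definition Dcol_count (Elocal : {set 'I_p * 'I_p}) (a k : 'I_p) : nat :=
  #|[set e in Da_edges Elocal a | (e.1 == k) || (e.2 == k)]|.

Definition fitloss (X : 'M[R]_(n, p)) (a : 'I_p) (theta : 'I_p -> R) : R :=
  n%:R^-1 * \sum_(i < n) (X i a - Xmul X a theta i) ^+ 2.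

Definition objective (X : 'M[R]_(n, p)) (a : 'I_p) (Elocal : {set 'I_p * 'I_p})
  (lam mu : R) (theta : 'I_p -> R) : R :=
  fitloss X a theta + lam * l1norm theta + mu * Dnorm Elocal a theta.

Definition is_estimator (X : 'M[R]_(n, p)) (a : 'I_p) (Elocal : {set 'I_p * 'I_p})
  (lam mu : R) (theta : 'I_p -> R) : Prop :=
  forall theta', objective X a Elocal lam mu theta <= objective X a Elocal lam mu theta'.

Definition compatibility (X : 'M[R]_(n, p)) (a : 'I_p) (S0 : {set 'I_p})
  (Delta phi0 : R) : Prop :=
  forall theta : 'I_p -> R,
    l1norm (restrC S0 theta) <= (3 + Delta) * l1norm (restr S0 theta) ->
    l1norm (restr S0 theta) ^+ 2 <=
      (#|S0|%:R * \sum_(i < n) (Xmul X a theta i) ^+ 2) / (n%:R * phi0 ^+ 2).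

Definition pos_def (Sigma : 'M[R]_p) : Prop :=
  Sigma^T = Sigma /\
  forall v : 'I_p -> R, (exists j, v j != 0) ->
    0 < \sum_(j < p) \sum_(k < p) v j * Sigma j k * v k.

(* theta0_a : population regression coefficients of X_a on the other variables:
   theta0_a(a) = 0 and Cov(X_b, X_a - sum_k theta0_k X_k) = 0 for b <> a,
   i.e. theta0_{a,b} = Sigma_bb^{-1} Sigma_ba. *)
Definition regression_coef (Sigma : 'M[R]_p) (a : 'I_p) (theta0 : 'I_p -> R) : Prop :=
  theta0 a = 0 /\
  forall b, b != a -> Sigma b a = \sum_(k < p) Sigma b k * theta0 k.

End Defs.

(* The n x p random matrix X has i.i.d. N(0, Sigma) rows: all entries are
   measurable and (Cramer-Wold) every nonzero linear combination
   sum_{i,j} C_ij X_ij is centred normal with variance sum_i C_i Sigma C_i'. *)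
Definition gaussian_design {d} {Omega : measurableType d} {R : realType}
  (P : probability Omega R) (n p : nat) (Sigma : 'M[R]_p)
  (X : Omega -> 'M[R]_(n, p)) : Prop :=
  (forall i j, measurable_fun setT (fun w => X w i j)) /\
  forall C : 'M[R]_(n, p), C != 0 ->
    forall A : set R, measurable A ->
      P ((fun w => \sum_(i < n) \sum_(j < p) C i j * X w i j) @^-1` A) =
      normal_prob 0
        (Num.sqrt (\sum_(i < n) \sum_(j < p) \sum_(k < p) C i j * Sigma j k * C i k)) A.

(* Main.v *)
Require Import Defs.
From HB Require Import structures.
From mathcomp Require Import all_boot all_order all_algebra.
From mathcomp Require Import all_classical all_reals all_analysis.
From mathcomp Require Import measurable_realfun ring lra.
Import Order.TTheory GRing.Theory Num.Theory.
Local Open Scope classical_set_scope.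
Local Open Scope ring_scope.

(** On the event that every correlation [|eps' X_j| / n] is at most
    [(lam + B mu) / 4], the basic inequality puts the estimation error in the
    compatibility cone, and compatibility together with AM-GM gives the bound.
    Writing [r = sqrt (2 (t + ln p) / n)], one has [lam = 2 r^2], [B mu = 4 r],
    and the threshold is [r^2 / 2 + r].

    For the event, polarisation gives
    [4 |eps' X_j| <= max (|eps + X_j|^2) (|eps - X_j|^2)], and both
    [eps + X_j] and [eps - X_j] have independent centred normal entries of
    variance at most 2, since [eps] and [X_j] are uncorrelated with variance at
    most 1.  Discarding the other square is harmless because [r >= 6]: the
    Chernoff bound for these chi-square variables is at most
    [exp (- n r^2 / 2) / 2 = exp (- t) / (2 p)], and there are [2 p] of them. *)

(** * Integration against a density and Gaussian exponential integrals *)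

Section density.
Import HBNNSimple.

(** For an indicator this is the assumption on [nu]. Linearity extends it to the simple functions
    [f_ n], and monotone convergence on both sides to [f]. *)
Lemma ge0_integral_density (d : measure_display) (T : measurableType d)
    (R : realType) (mu nu : {measure set T -> \bar R}) (h : T -> R)
    (f : T -> \bar R) :
  measurable_fun setT h -> (forall x, 0 <= h x) ->
  (forall A, measurable A -> nu A = \int[mu]_(x in A) (h x)%:E)%E ->
  measurable_fun setT f -> (forall x, 0 <= f x)%E ->
  (\int[nu]_x f x = \int[mu]_x (f x * (h x)%:E))%E.
Proof.
move=> mh h0 nuE mf f0.
pose f_ := nnsfun_approx measurableT mf.
have cvgf x : (f_ n x)%:E @[n --> \oo] --> f x by exact: cvg_nnsfun_approx.
have mfh n : measurable_fun setT (fun x => (f_ n x)%:E * (h x)%:E)%E.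
  by apply: emeasurable_funM; exact/measurable_EFinP.
have -> : (\int[nu]_x f x = limn (fun n => \int[nu]_x (f_ n x)%:E))%E.
  rewrite -monotone_convergence//.
  - by apply: eq_integral => x _; apply/esym/cvg_lim.
  - by move=> n; exact/measurable_EFinP/measurable_funP.
  - by move=> n x _; rewrite lee_fin.
  - by move=> x _ m n mn; rewrite lee_fin; exact/lefP/nd_nnsfun_approx.
have -> : (\int[mu]_x (f x * (h x)%:E) =
    limn (fun n => \int[mu]_x ((f_ n x)%:E * (h x)%:E)))%E.
  rewrite -monotone_convergence//.
  - by apply: eq_integral => x _; apply/esym/cvg_lim => //; exact: cvgeZr.
  - by move=> n x _; rewrite mule_ge0// lee_fin.
  - move=> x _ m n mn; rewrite lee_wpmul2r ?lee_fin//.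
    exact/lefP/nd_nnsfun_approx.
congr (limn _); apply/funext => n.
transitivity (\sum_(k \in range (f_ n))
    (\int[nu]_x (k * \1_(f_ n @^-1` [set k]) x)%:E))%E.
  rewrite -ge0_integral_fsum//.
  - by apply: eq_integral => x _; rewrite fsumEFin// -fimfunE.
  - by move=> r; exact/measurable_EFinP/measurable_funM.
  - by move=> r x _; rewrite nnfun_muleindic_ge0.
transitivity (\sum_(k \in range (f_ n))
    (\int[mu]_x ((k * \1_(f_ n @^-1` [set k]) x)%:E * (h x)%:E)))%E; last first.
  rewrite -ge0_integral_fsum//.
  - apply: eq_integral => x _; rewrite -ge0_mule_fsuml.
      by rewrite fsumEFin// -fimfunE.
    by move=> r; rewrite nnfun_muleindic_ge0.
  - by move=> r; apply: emeasurable_funM; apply/measurable_EFinP => //;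
      exact: measurable_funM.
  - by move=> r x _; rewrite mule_ge0 ?nnfun_muleindic_ge0// lee_fin.
apply: eq_fsbigr => r; rewrite inE => -[y _ <-].
rewrite integralZl_indic_nnsfun// integral_indic//= setIT nuE//.
under [RHS]eq_integral do rewrite EFinM -muleA.
rewrite ge0_integralZl_EFin//.
- congr (_ * _)%E; rewrite integral_mkcond; apply: eq_integral => x _.
  by rewrite patchE indicE; case: ifPn => _; rewrite ?mul1e ?mul0e.
- by move=> x _; rewrite mule_ge0// lee_fin.
- by apply: emeasurable_funM; exact/measurable_EFinP.
Qed.

End density.

(** Completing the square: an exponential tilt moves the mean to [s ^+ 2 * u] and leaves the
    variance alone. *)
Lemma expR_mul_normal_pdf (R : realType) (s u x : R) : s != 0 ->
  expR (u * x) * normal_pdf 0 s x =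
  expR (s ^+ 2 * u ^+ 2 / 2) * normal_pdf (s ^+ 2 * u) s x.
Proof.
move=> s0; rewrite !normal_pdfE// !(mulrCA _ (normal_peak s)); congr (_ * _).
rewrite /normal_fun -!expRD; congr expR; field.
exact: s0.
Qed.

Lemma integral_expR_normal_pdf (R : realType) (s u : R) : s != 0 ->
  (\int[lebesgue_measure]_x (expR (u * x) * normal_pdf 0 s x)%:E =
   (expR (s ^+ 2 * u ^+ 2 / 2))%:E)%E.
Proof.
move=> s0.
under eq_integral do rewrite expR_mul_normal_pdf// EFinM.
rewrite ge0_integralZl_EFin ?integral_normal_pdf ?mule1//.
- by move=> x _; rewrite lee_fin normal_pdf_ge0.
- by apply/measurable_EFinP; exact: measurable_normal_pdf.
Qed.

(** A quadratic tilt keeps the mean and changes the variance from 1 to [1 / (1 - k)]; the prefactor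
    is the ratio of the two peaks. *)
Lemma expR_sqr_mul_normal_pdf (R : realType) (k x : R) : k < 1 ->
  expR (k * x ^+ 2 / 2) * normal_pdf 0 1 x =
  (Num.sqrt (1 - k))^-1 * normal_pdf 0 (Num.sqrt (1 - k))^-1 x.
Proof.
move=> k1; have k0 : 0 < 1 - k by rewrite subr_gt0.
have sk : Num.sqrt (1 - k) != 0 by rewrite gt_eqF// sqrtr_gt0.
rewrite !normal_pdfE ?oner_eq0 ?invr_eq0// mulrCA [RHS]mulrA; congr (_ * _).
  rewrite /normal_peak expr1n mul1r exprVn sqr_sqrtr ?ltW//.
  rewrite -mulrnAr sqrtrM ?invr_ge0 ?ltW// sqrtrV ?ltW// invfM invrK.
  by rewrite mulrA mulVf// mul1r.
rewrite /normal_fun -!expRD; congr expR.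
rewrite exprVn sqr_sqrtr ?ltW//; field.
by rewrite gt_eqF.
Qed.

Lemma integral_expR_sqr_normal_pdf (R : realType) (k : R) : k < 1 ->
  (\int[lebesgue_measure]_x (expR (k * x ^+ 2 / 2) * normal_pdf 0 1 x)%:E =
   (Num.sqrt (1 - k))^-1%:E)%E.
Proof.
move=> k1.
under eq_integral do rewrite expR_sqr_mul_normal_pdf// EFinM.
rewrite ge0_integralZl_EFin ?integral_normal_pdf ?mule1//.
- by move=> x _; rewrite lee_fin normal_pdf_ge0.
- by apply/measurable_EFinP; exact: measurable_normal_pdf.
Qed.

Lemma mgf_normal (d : measure_display) (T : measurableType d) (R : realType)
    (P : probability T R) (Y : T -> R) (s : R) : s != 0 ->
  measurable_fun setT Y ->
  (forall A, measurable A -> P (Y @^-1` A) = normal_prob 0 s A) ->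
  (\int[P]_w (expR (Y w))%:E = (expR (s ^+ 2 / 2))%:E)%E.
Proof.
move=> s0 mY PY.
have mE : measurable_fun setT (fun x : R => (expR x)%:E).
  by apply/measurable_EFinP; exact: measurable_expR.
transitivity (\int[pushforward P (Y : T -> measurableTypeR R)]_x (expR x)%:E)%E.
  by rewrite ge0_integral_pushforward// => x _; rewrite lee_fin expR_ge0.
rewrite (@eq_measure_integral _ _ _ _ (normal_prob 0 s)); last first.
  by move=> A mA _; exact: PY.
rewrite (ge0_integral_density _ _ _ lebesgue_measure (normal_prob 0 s)
  (normal_pdf 0 s))//.
- under eq_integral do rewrite -EFinM -[X in expR X]mul1r.
  by rewrite integral_expR_normal_pdf// expr1n mulr1.
- exact: measurable_normal_pdf.
- by move=> x; exact: normal_pdf_ge0.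
Qed.

(** * Chi-square tail bound *)

Section sum_of_squares.
Context (d : measure_display) (T : measurableType d) (R : realType).
Context (P : probability T R) (n : nat) (W : 'I_n -> T -> R) (v : R).
Hypothesis mW : forall i, measurable_fun setT (W i).
(** This is the joint moment generating function of independent centred normals of variance [v];
    independence enters only in this form. *)
Hypothesis mgfW : forall c : 'I_n -> R,
  (\int[P]_w (expR (\sum_(i < n) c i * W i w))%:E =
   (expR (v * (\sum_(i < n) c i ^+ 2) / 2))%:E)%E.

(* Each square is linearised by [exp (a^2 y^2 / 2) = E exp (a g y)] for an
   auxiliary standard normal [g], so only linear combinations of the [W i] are
   ever integrated. *)
Lemma mgf_sum_sqr_seq (a : R) (s : seq 'I_n) : a ^+ 2 * v < 1 -> uniq s ->
  forall c : 'I_n -> R, (forall i, i \in s -> c i = 0) ->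
  (\int[P]_w (expR (a ^+ 2 / 2 * (\sum_(i <- s) W i w ^+ 2) +
                    \sum_(i < n) c i * W i w))%:E =
   ((Num.sqrt (1 - a ^+ 2 * v))^-1 ^+ size s *
    expR (v * (\sum_(i < n) c i ^+ 2) / 2))%:E)%E.
Proof.
move=> av1; elim: s => [_ c _|i0 s IH /= /andP[i0s us] c c0].
  under eq_integral do rewrite big_nil mulr0 add0r.
  by rewrite mgfW expr0 mul1r.
(* Linearising the square of [W i0] puts the coefficient [a * g] on [W i0]. Since [c i0 = 0], the
   sum of squared coefficients gains exactly [(a * g) ^+ 2], with no cross term. *)
pose c' g i := c i + (if i == i0 then a * g else 0).
have ci0 : c i0 = 0 by rewrite c0// mem_head.
have c'0 g i : i \in s -> c' g i = 0.
  move=> si; rewrite /c' c0 ?inE ?si ?orbT// add0r ifF//.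
  by apply/negbTE; apply: contraNneq i0s => <-.
have sumc' g w : \sum_(i < n) c' g i * W i w =
    \sum_(i < n) c i * W i w + a * g * W i0 w.
  under eq_bigr do rewrite mulrDl.
  rewrite big_split/= [X in _ + X](bigD1 i0)//= eqxx; congr (_ + _).
  rewrite [X in _ + X]big1 ?addr0//.
  by move=> i /negbTE ->; rewrite mul0r.
have sumc2 g : \sum_(i < n) c' g i ^+ 2 = \sum_(i < n) c i ^+ 2 + (a * g) ^+ 2.
  rewrite (bigD1 i0)//= [in RHS](bigD1 i0)//= ci0 /c' eqxx ci0 add0r expr0n add0r.
  rewrite addrC; congr (_ + _); apply: eq_bigr => i /negbTE ->.
  by rewrite addr0.
pose f (z : T * measurableTypeR R) := expR (a ^+ 2 / 2 * (\sum_(i <- s) W i z.1 ^+ 2) +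
  (\sum_(i < n) c i * W i z.1 + a * z.2 * W i0 z.1)) * normal_pdf 0 1 z.2.
have mWz i : measurable_fun setT (fun z : T * measurableTypeR R => W i z.1).
  by apply: measurableT_comp => //; exact: measurable_fst.
have mf : measurable_fun setT (fun z => (f z)%:E).
  apply/measurable_EFinP/measurable_funM; last first.
    by apply: measurableT_comp; [exact: measurable_normal_pdf|exact: measurable_snd].
  apply: measurableT_comp; first exact: measurable_expR.
  apply: measurable_funD.
    apply: measurable_funM => //; apply: measurable_sum => i.
    exact: measurable_funX.
  apply: measurable_funD.
    by apply: measurable_sum => i; exact: measurable_funM.
  by apply: measurable_funM => //; exact: measurable_funM.
transitivity (\int[P]_w \int[lebesgue_measure]_g (f (w, g))%:E)%E.
  apply: eq_integral => w _; rewrite /f /=.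
  set A := _ * \sum_(i <- s) _; set B := \sum_(i < n) _.
  under eq_integral => g _.
    rewrite addrA expRD -mulrA EFinM.
    rewrite (_ : a * g * W i0 w = (a * W i0 w) * g); last by ring.
    over.
  rewrite ge0_integralZl_EFin ?expR_ge0//.
  - rewrite integral_expR_normal_pdf ?oner_eq0// -EFinM -expRD; congr (expR _)%:E.
    by rewrite /A /B big_cons; field.
  - by move=> g _; rewrite lee_fin mulr_ge0 ?expR_ge0 ?normal_pdf_ge0.
  - apply/measurable_EFinP/measurable_funM; last exact: measurable_normal_pdf.
    by apply: measurableT_comp => //; exact: measurable_funM.
(* Integrating over [P] first lets the induction hypothesis apply with [c' g] for each fixed [g];
   the remaining integral over [g] is a quadratic tilt and yields one more factor [K]. *)
rewrite (fubini_tonelli (fun z => (f z)%:E))//; last first.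
  by move=> z; rewrite lee_fin mulr_ge0 ?expR_ge0 ?normal_pdf_ge0.
set K := (Num.sqrt _)^-1.
have inner g : (\int[P]_w (f (w, g))%:E =
    (K ^+ size s * expR (v * (\sum_(i < n) c i ^+ 2) / 2))%:E *
    (expR ((a ^+ 2 * v) * g ^+ 2 / 2) * normal_pdf 0 1 g)%:E)%E.
  rewrite /f/=; under eq_integral do rewrite mulrC EFinM -sumc'.
  rewrite ge0_integralZl_EFin ?normal_pdf_ge0//.
  - rewrite IH//; last exact: c'0.
    rewrite sumc2 -!EFinM -/K; congr (_%:E).
    rewrite (_ : v * _ / 2 = v * (\sum_(i < n) c i ^+ 2) / 2 +
      a ^+ 2 * v * g ^+ 2 / 2); last by field.
    by rewrite expRD; ring.
  - apply/measurable_EFinP/measurableT_comp; first exact: measurable_expR.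
    apply: measurable_funD.
      apply: measurable_funM => //; apply: measurable_sum => i.
      exact: measurable_funX.
    by apply: measurable_sum => i; exact: measurable_funM.
under eq_integral do rewrite inner.
rewrite ge0_integralZl_EFin//.
- rewrite integral_expR_sqr_normal_pdf// -EFinM -/K exprS; congr (_%:E); ring.
- by move=> g _; rewrite lee_fin mulr_ge0 ?expR_ge0 ?normal_pdf_ge0.
- apply/measurable_EFinP/measurable_funM; last exact: measurable_normal_pdf.
  apply: measurableT_comp => //; apply: measurable_funM => //.
  apply: measurable_funM => //.
- by rewrite mulr_ge0 ?expR_ge0// exprn_ge0// invr_ge0 sqrtr_ge0.
Qed.

(** Chernoff's bound at [a ^+ 2 / 2], with the moment generating function taken from
    [mgf_sum_sqr_seq] for all indices and [c = 0]. *)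
Lemma sum_sqr_tail (a y : R) : 0 < a -> a ^+ 2 * v < 1 ->
  (P [set w | y <= \sum_(i < n) W i w ^+ 2]%R <=
   ((Num.sqrt (1 - a ^+ 2 * v))^-1 ^+ n * expR (- (a ^+ 2 / 2 * y)))%:E)%E.
Proof.
move=> a0 av1.
have mS : measurable_fun setT (fun w => \sum_(i < n) W i w ^+ 2).
  by apply: measurable_sum => i; exact: measurable_funX.
pose S : {RV P >-> R} := HB.pack (fun w => \sum_(i < n) W i w ^+ 2)
  (isMeasurableFun.Build _ _ _ _ _ mS).
have r0 : 0 < a ^+ 2 / 2 by rewrite divr_gt0// exprn_gt0.
apply: (le_trans (chernoff S y r0)).
rewrite EFinM lee_wpmul2r ?lee_fin ?expR_ge0//.
rewrite /mmt_gen_fun unlock/=.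
have := mgf_sum_sqr_seq a (index_enum 'I_n) av1 (index_enum_uniq _)
  (fun=> 0) (fun _ _ => erefl).
have -> : size (index_enum 'I_n) = n.
  by rewrite [index_enum _]unlock -enumT size_enum_ord.
rewrite [X in v * X]big1; last by move=> i _; rewrite expr0n.
rewrite mulr0 mul0r expR0 mulr1 => <-.
rewrite le_eqVlt; apply/orP; left; apply/eqP; apply: eq_integral => w _.
congr (expR _)%:E; rewrite [X in _ + X]big1 ?addr0; last by move=> i _; rewrite mul0r.
by rewrite mulrC.
Qed.

End sum_of_squares.

(** * Deterministic part: penalties, basic inequality, oracle inequality *)

(** Each edge is charged to its two endpoints; after exchanging the sums, [k] is charged once per
    edge that touches it. *)
Lemma Dnorm_le_l1norm (R : realType) (p : nat) (E : {set 'I_p * 'I_p})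
    (a : 'I_p) (B : nat) (theta : 'I_p -> R) :
  (forall e, e \in E -> (e.1 < e.2)%N) ->
  (forall k, (Dcol_count E a k <= B)%N) ->
  Dnorm E a theta <= B%:R * l1norm theta.
Proof.
move=> ltE colB.
have endpoints e : e \in Da_edges E a ->
    `|theta e.1 - theta e.2| <=
      \sum_(k < p | (e.1 == k) || (e.2 == k)) `|theta k|.
  rewrite inE => /andP[/ltE e12 _].
  (* The endpoints are distinct, so both terms can be extracted from the sum. *)
  have ne : e.2 != e.1 by rewrite -val_eqE/= gtn_eqF.
  rewrite (bigD1 e.1) ?eqxx//= (bigD1 e.2) ?eqxx ?orbT//=.
  by rewrite addrA ler_wpDr ?sumr_ge0// ler_normB.
apply: (le_trans (ler_sum _ endpoints)).
rewrite (exchange_big_dep predT)//= /l1norm mulr_sumr; apply: ler_sum => k _.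
rewrite sumr_const -[leLHS]mulr_natl ler_wpM2r// ler_nat.
apply: leq_trans (colB k); rewrite /Dcol_count.
by rewrite cardsE.
Qed.

Lemma l1normD_split (R : realType) (p : nat) (S : {set 'I_p})
    (theta : 'I_p -> R) :
  l1norm theta = l1norm (restr S theta) + l1norm (restrC S theta).
Proof.
rewrite /l1norm -big_split/=; apply: eq_bigr => j _.
by rewrite /restr /restrC; case: ifP => _; rewrite normr0 ?addr0 ?add0r.
Qed.

Lemma Dnorm_subadditive (R : realType) (p : nat) (E : {set 'I_p * 'I_p})
    (a : 'I_p) (theta theta' : 'I_p -> R) :
  Dnorm E a theta <= Dnorm E a theta' + Dnorm E a (fun j => theta' j - theta j).
Proof.
rewrite /Dnorm -big_split/=; apply: ler_sum => e _.
rewrite (_ : theta e.1 - theta e.2 = (theta' e.1 - theta' e.2) -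
  ((theta' e.1 - theta e.1) - (theta' e.2 - theta e.2))); last by ring.
exact: ler_normB.
Qed.

Lemma XmulB (R : realType) (n p : nat) (X : 'M[R]_(n, p)) (a : 'I_p)
    (theta theta' : 'I_p -> R) (i : 'I_n) :
  Xmul X a (fun j => theta j - theta' j) i =
  Xmul X a theta i - Xmul X a theta' i.
Proof. by rewrite /Xmul -sumrB; apply: eq_bigr => j _; rewrite mulrBr. Qed.

(** Duality of the sup norm and the l1 norm, after exchanging the sums. *)
Lemma noise_inner_le (R : realType) (n p : nat) (X : 'M[R]_(n, p)) (a : 'I_p)
    (e : 'I_n -> R) (x : R) (delta : 'I_p -> R) :
  (forall j, `|\sum_(i < n) e i * Xminus X a i j| <= x) ->
  \sum_(i < n) e i * Xmul X a delta i <= x * l1norm delta.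
Proof.
move=> noise; under eq_bigr do rewrite mulr_sumr.
rewrite exchange_big/= /l1norm mulr_sumr; apply: ler_sum => j _.
under eq_bigr do rewrite mulrA.
rewrite -mulr_suml (le_trans (ler_norm _))// normrM.
by rewrite ler_wpM2r.
Qed.

(** The minimiser is compared with [theta0]. Its residual is that of [theta0] minus the fitted
    error, so the squared residuals of [theta0] cancel and a cross term remains. *)
Lemma basic_inequality (R : realType) (n p : nat) (X : 'M[R]_(n, p)) (a : 'I_p)
    (E : {set 'I_p * 'I_p}) (lam mu : R) (theta0 theta : 'I_p -> R) :
  is_estimator X a E lam mu theta ->
  n%:R^-1 * \sum_(i < n) (Xmul X a (fun j => theta j - theta0 j) i) ^+ 2
    + lam * l1norm theta + mu * Dnorm E a theta <=
  n%:R^-1 * (2 * \sum_(i < n) (X i a - Xmul X a theta0 i) *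
                  Xmul X a (fun j => theta j - theta0 j) i)
    + lam * l1norm theta0 + mu * Dnorm E a theta0.
Proof.
move=> /(_ theta0); rewrite /objective /fitloss.
set Q := \sum_(i < n) (Xmul _ _ _ _) ^+ 2; set N := \sum_(i < n) _ * _.
rewrite (_ : \sum_(i < n) (X i a - Xmul X a theta i) ^+ 2 =
  \sum_(i < n) (X i a - Xmul X a theta0 i) ^+ 2 + (Q - 2 * N)).
  by rewrite mulrDr mulrBr => h; lra.
rewrite /Q /N mulr_sumr -sumrB -big_split/=; apply: eq_bigr => i _.
by rewrite XmulB; ring.
Qed.

(** Coordinatewise: off the support [theta0] vanishes and equality holds; on it this is the triangle
    inequality. *)
Lemma l1norm_penalty_gap (R : realType) (p : nat) (theta0 theta : 'I_p -> R) :
  l1norm theta0 - l1norm theta <=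
    l1norm (restr [set j | theta0 j != 0]%SET (fun j => theta j - theta0 j)) -
    l1norm (restrC [set j | theta0 j != 0]%SET (fun j => theta j - theta0 j)).
Proof.
rewrite /l1norm -!sumrB; apply: ler_sum => j _.
rewrite /restr /restrC inE; case: eqVneq => [->|_] /=.
  by rewrite !normr0 !sub0r subr0.
by rewrite normr0 subr0 lerBlDr -[X in `|X|](subKr (theta j)) distrC ler_normB.
Qed.

(* [y] and [z] stand for the l1 norms of the error on and off the support *)
Lemma oracle_arithmetic (R : realType) (Q y z lam M Delta K : R) :
  0 < Delta -> 0 < M -> 0 <= Q -> 0 <= y -> 0 <= z -> 0 <= K ->
  (3 + 14 / Delta) * M <= lam ->
  Q + lam * (z - y) <= (lam + M) / 2 * (y + z) + M * (y + z) ->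
  (z <= (3 + Delta) * y -> y ^+ 2 <= K * Q) ->
  Q + (lam - 3 * M) * (y + z) <= K * (2 * lam + M) ^+ 2.
Proof.
move=> D0 M0 Q0 y0 z0 K0 lamM basic compat.
have gap : 14 * M <= Delta * (lam - 3 * M).
  rewrite -ler_pdivrMl//; move: lamM.
  rewrite (_ : Delta^-1 * (14 * M) = 14 / Delta * M); last by ring.
  by move=> ?; lra.
have lam3 : 0 < lam - 3 * M.
  by rewrite -(pmulr_rgt0 _ D0); apply: lt_le_trans gap; lra.
(* [basic] gives [2 Q + (lam - 3 M) z <= (3 lam + 3 M) y]. The cone follows because [(3 + Delta)
   (lam - 3 M) - (3 lam + 3 M) = Delta (lam - 3 M) - 12 M], which [gap] makes nonnegative. *)
have cone : z <= (3 + Delta) * y.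
  rewrite -(ler_pM2l lam3).
  have h1 : (lam - 3 * M) * z <= (3 * lam + 3 * M) * y by lra.
  apply: (le_trans h1); rewrite mulrA ler_wpM2r//; lra.
have yKQ := compat cone.
(* AM-GM, proved on squares: [(Q + 4 lam^2 K)^2] exceeds [16 lam^2 K Q] by [(Q - 4 lam^2 K)^2].
   Adding [(lam - 3 M) y] to the rearranged [basic] bounds [2 Q + (lam - 3 M) (y + z)] by [4 lam y],
   so one [Q] survives. *)
have sq : 4 * lam * y <= Q + 4 * lam ^+ 2 * K.
  have rhs0 : 0 <= Q + 4 * lam ^+ 2 * K.
    by rewrite addr_ge0// mulr_ge0// mulr_ge0// sqr_ge0.
  rewrite (le_trans (ler_norm _))// -(ger0_norm rhs0) -ler_sqr ?nnegrE//.
  rewrite !real_normK ?num_real//.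
  have h : 0 <= (Q - 4 * lam ^+ 2 * K) ^+ 2 by exact: sqr_ge0.
  have h2 : lam ^+ 2 * y ^+ 2 <= lam ^+ 2 * (K * Q).
    by rewrite ler_wpM2l// sqr_ge0.
  by rewrite !expr2 in h h2 *; lra.
have h : K * (2 * lam) ^+ 2 <= K * (2 * lam + M) ^+ 2.
  by rewrite ler_wpM2l// ler_sqr ?nnegrE; lra.
by rewrite !expr2 in h sq *; lra.
Qed.

Lemma oracle_inequality (R : realType) (n p : nat) (X : 'M[R]_(n, p))
    (a : 'I_p) (theta0 theta : 'I_p -> R) (E : {set 'I_p * 'I_p}) (B : nat)
    (lam mu Delta phi0 : R) :
  let S0 := finset (fun j : 'I_p => theta0 j != 0) in
  (0 < n)%N -> (0 < B)%N -> 0 < mu -> 0 < Delta ->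
  (forall e, e \in E -> (e.1 < e.2)%N) ->
  (forall k, (Dcol_count E a k <= B)%N) ->
  (3 + 14 / Delta) * (B%:R * mu) <= lam ->
  (forall j, `|\sum_(i < n) (X i a - Xmul X a theta0 i) * Xminus X a i j| <=
             n%:R * ((lam + B%:R * mu) / 4)) ->
  compatibility X a S0 Delta phi0 ->
  is_estimator X a E lam mu theta ->
  n%:R^-1 * \sum_(i < n) (Xmul X a (fun j => theta j - theta0 j) i) ^+ 2
    + (lam - 3 * B%:R * mu) * l1norm (fun j => theta j - theta0 j)
  <= #|S0|%:R * (2 * lam + B%:R * mu) ^+ 2 / phi0 ^+ 2.
Proof.
move=> S0 n0 B0 mu0 D0 ltE colB lamM noise compat /(basic_inequality _ _ _ _ _ _ _ _ theta0) est.
set delta := fun j => theta j - theta0 j.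
have M0 : 0 < B%:R * mu by rewrite mulr_gt0// ltr0n.
have nn0 : 0 < n%:R :> R by rewrite ltr0n.
have lam0 : 0 <= lam.
  by apply: le_trans lamM; rewrite mulr_ge0 ?ltW// addr_gt0// divr_gt0.
rewrite (l1normD_split _ _ S0) -/delta.
rewrite -[3 * _ * _]mulrA -[_ * _ / phi0 ^+ 2]mulrAC.
(* Here [K] is [#|S0| / phi0^2] and [Q] is the prediction error, including its factor [1 / n]. *)
apply: (@oracle_arithmetic _ _ _ _ lam (B%:R * mu) Delta) => //.
- by rewrite mulr_ge0 ?invr_ge0 ?ler0n// sumr_ge0// => i _; exact: sqr_ge0.
- exact: sumr_ge0.
- exact: sumr_ge0.
- by rewrite mulr_ge0 ?invr_ge0 ?sqr_ge0// ler0n.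
- have gap := ler_wpM2l lam0 (l1norm_penalty_gap _ _ theta0 theta).
  (* The change in the fusion penalty costs at most [B mu] times the l1 error; the doubled cross
     term costs [(lam + B mu) / 2] times it. *)
  have := ler_wpM2l (ltW mu0) (Dnorm_subadditive _ _ E a theta0 theta).
  have := ler_wpM2l (ltW mu0) (Dnorm_le_l1norm _ _ E a B delta ltE colB).
  have noise' : n%:R^-1 * (2 * \sum_(i < n) (X i a - Xmul X a theta0 i) *
      Xmul X a delta i) <= (lam + B%:R * mu) / 2 * l1norm delta.
    rewrite ler_pdivrMl// -ler_pdivlMl//.
    apply: le_trans (noise_inner_le _ _ _ _ _ _ _ delta noise) _.
    by rewrite le_eqVlt; apply/orP; left; apply/eqP; field.
  rewrite -(l1normD_split _ _ S0 delta); rewrite -/delta -/S0 in gap est.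
  by move: gap est noise'; rewrite !mulrBr !mulrDr; move=> *; lra.
- move=> cone; apply: le_trans (compat delta cone) _.
  rewrite le_eqVlt; apply/orP; left; apply/eqP; rewrite invfM.
  by ring.
Qed.

(** * Gaussian row combinations and their variances *)

Definition quad_form (R : realType) (p : nat) (Sigma : 'M[R]_p)
    (v : 'I_p -> R) : R :=
  \sum_(j < p) \sum_(k < p) v j * Sigma j k * v k.

(** The coefficients that express the noise [eps] as a combination of the entries of a row. *)
Definition residual_dir (R : realType) (p : nat) (a : 'I_p)
    (theta0 : 'I_p -> R) (k : 'I_p) : R :=
  (k == a)%:R - theta0 k.

Arguments quad_form {R p}.
Arguments residual_dir {R p}.

Section gaussian_combination.
Context (d : measure_display) (Omega : measurableType d) (R : realType).
Context (P : probability Omega R) (n p : nat) (Sigma : 'M[R]_p).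
Context (X : Omega -> 'M[R]_(n, p)).
Hypothesis XP : gaussian_design P Sigma X.

Lemma measurable_row_combination (v : 'I_p -> R) (i : 'I_n) :
  measurable_fun setT (fun w => \sum_(k < p) v k * X w i k).
Proof.
apply: measurable_sum => k; apply: measurable_funM => //.
exact: (proj1 XP).
Qed.

(** The design assumption is applied to the rank-one matrix with entries [c i * v k], whose variance
    factors as [quad_form Sigma v] times the squared norm of [c]. *)
Lemma mgf_gaussian_combination (v : 'I_p -> R) :
  (exists k, v k != 0) -> 0 < quad_form Sigma v ->
  forall c : 'I_n -> R,
  (\int[P]_w (expR (\sum_(i < n) c i * \sum_(k < p) v k * X w i k))%:E =
   (expR (quad_form Sigma v * (\sum_(i < n) c i ^+ 2) / 2))%:E)%E.
Proof.
move=> [k0 vk0] V0 c.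
(* [gaussian_design] speaks of nonzero matrices only, so [c = 0] is computed directly. *)
have [c0|[i0 ci0]] : (forall i, c i = 0) \/ exists i, c i != 0.
  have [/forallP c0|] := boolP [forall i, c i == 0].
    by left=> i; exact/eqP.
  by rewrite negb_forall => /existsP; right.
- under eq_integral => w _.
    rewrite big1 ?expR0; last by move=> i _; rewrite c0 mul0r.
    over.
  rewrite integral_cst//= mul1e probability_setT big1 ?mulr0 ?mul0r ?expR0//.
  by move=> i _; rewrite c0 expr0n.
pose C : 'M[R]_(n, p) := \matrix_(i, k) (c i * v k).
have C0 : C != 0.
  apply/eqP => /matrixP/(_ i0 k0)/eqP.
  by rewrite !mxE mulf_eq0 (negbTE ci0) (negbTE vk0).
have CX w : \sum_(i < n) \sum_(k < p) C i k * X w i k =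
    \sum_(i < n) c i * \sum_(k < p) v k * X w i k.
  apply: eq_bigr => i _; rewrite mulr_sumr; apply: eq_bigr => k _.
  by rewrite mxE mulrA.
have varC : \sum_(i < n) \sum_(j < p) \sum_(k < p) C i j * Sigma j k * C i k =
    quad_form Sigma v * \sum_(i < n) c i ^+ 2.
  rewrite mulr_sumr; apply: eq_bigr => i _.
  rewrite /quad_form mulr_suml; apply: eq_bigr => j _.
  rewrite mulr_suml; apply: eq_bigr => k _.
  by rewrite !mxE; ring.
have varC0 : 0 < quad_form Sigma v * \sum_(i < n) c i ^+ 2.
  rewrite mulr_gt0// (bigD1 i0)//= ltr_pwDl ?exprn_even_gt0//.
  by rewrite sumr_ge0// => i _; exact: sqr_ge0.
rewrite -[X in expR (X / 2)]sqr_sqrtr ?(ltW varC0)//.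
apply: mgf_normal.
- by rewrite gt_eqF// sqrtr_gt0.
- apply: measurable_sum => i; apply: measurable_funM => //.
  exact: measurable_row_combination.
- move=> A mA; have := (proj2 XP) C C0 A mA; rewrite varC => <-.
  by congr (P _); apply/seteqP; split => w /=; rewrite CX.
Qed.

Lemma gaussian_combination_tail (v : 'I_p -> R) (a y : R) :
  (exists k, v k != 0) -> 0 < quad_form Sigma v -> 0 < a ->
  a ^+ 2 * quad_form Sigma v < 1 ->
  (P [set w | y <= \sum_(i < n) (\sum_(k < p) v k * X w i k) ^+ 2]%R <=
   ((Num.sqrt (1 - a ^+ 2 * quad_form Sigma v))^-1 ^+ n *
    expR (- (a ^+ 2 / 2 * y)))%:E)%E.
Proof.
move=> v0 V0 a0 aV.
apply: (@sum_sqr_tail _ _ _ P n (fun i w => \sum_(k < p) v k * X w i k)) => //.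
  exact: measurable_row_combination.
exact: mgf_gaussian_combination.
Qed.

End gaussian_combination.

Section regression_variance.
Context (R : realType) (p : nat) (Sigma : 'M[R]_p) (a : 'I_p).
Context (theta0 : 'I_p -> R).
Hypothesis SigmaP : pos_def Sigma.
Hypothesis Sigma1 : forall i, Sigma i i = 1.
Hypothesis theta0P : regression_coef Sigma a theta0.

Lemma quad_form_ge0 (v : 'I_p -> R) : 0 <= quad_form Sigma v.
Proof.
have [/forallP v0|] := boolP [forall k, v k == 0].
  rewrite /quad_form big1// => j _; rewrite big1// => k _.
  by rewrite (eqP (v0 k)) mulr0.
by rewrite negb_forall => /existsP vP; apply/ltW; exact: (proj2 SigmaP).
Qed.

Let Sigma_sym j k : Sigma j k = Sigma k j.
Proof. by have /matrixP/(_ k j) := proj1 SigmaP; rewrite mxE. Qed.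

Lemma residual_cov0 (b : 'I_p) : b != a ->
  \sum_(k < p) Sigma b k * residual_dir a theta0 k = 0.
Proof.
move=> ba; under eq_bigr do rewrite mulrBr.
rewrite sumrB -(proj2 theta0P b ba) (bigD1 a)//= eqxx mulr1 big1 ?addr0 ?subrr//.
by move=> k /negbTE ->; rewrite mulr0.
Qed.

(** By the normal equations the left side is 1 minus the explained variance
    [quad_form Sigma theta0], which is nonnegative. *)
Lemma residual_cov_le1 :
  \sum_(k < p) Sigma a k * residual_dir a theta0 k <= 1.
Proof.
under eq_bigr do rewrite mulrBr.
rewrite sumrB (bigD1 a)//= eqxx mulr1 Sigma1 big1 ?addr0; last first.
  by move=> k /negbTE ->; rewrite mulr0.
rewrite lerBlDr lerDl.
have := quad_form_ge0 theta0; rewrite /quad_form.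
rewrite (eq_bigr (fun j => Sigma a j * theta0 j))// => j _.
have [->|ja] := eqVneq j a.
  by rewrite (proj1 theta0P) mulr0 big1// => k _; rewrite !mul0r.
under eq_bigr do rewrite -mulrA.
by rewrite -mulr_sumr -(proj2 theta0P j ja) Sigma_sym mulrC.
Qed.

(* [X_a - X theta0] is uncorrelated with [X_j], so the variances add up. *)
Lemma quad_form_residualD (j : 'I_p) (b : bool) : j != a ->
  quad_form Sigma (fun k => residual_dir a theta0 k + (-1) ^+ b * (k == j)%:R)
  <= 2.
Proof.
move=> ja; set u := residual_dir a theta0; set e : R := (-1) ^+ b.
have row i : \sum_(k < p) Sigma i k * (u k + e * (k == j)%:R) =
    \sum_(k < p) Sigma i k * u k + e * Sigma i j.
  under eq_bigr do rewrite mulrDr.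
  rewrite big_split/= [X in _ + X](bigD1 j)//= eqxx mulr1 [X in _ * e + X]big1 ?addr0.
    by rewrite [e * _]mulrC.
  by move=> k /negbTE ->; rewrite !mulr0.
pose r i := \sum_(k < p) Sigma i k * u k.
have rj : r j = 0 by exact: residual_cov0.
have ua : u a = 1 by rewrite /u /residual_dir eqxx (proj1 theta0P) subr0.
have expand : quad_form Sigma (fun k => u k + e * (k == j)%:R) =
    \sum_(i < p) r i * u i + e * \sum_(i < p) Sigma j i * u i +
    \sum_(i < p) (i == j)%:R * (e * (r i + e * Sigma i j)).
  rewrite mulr_sumr -!big_split/=; apply: eq_bigr => i _.
  under eq_bigr do rewrite -mulrA.
  by rewrite -mulr_sumr row -/(r i) (Sigma_sym j i); ring.
rewrite expand -/(r j) rj mulr0 addr0.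
rewrite [X in _ + X](bigD1 j)//= [X in _ + (_ + X)]big1; last first.
  by move=> i /negbTE ->; rewrite mul0r.
rewrite eqxx rj add0r Sigma1 mulr1 mul1r addr0 -expr2 sqrr_sign.
(* [r] vanishes off [a] and [u a = 1], so the residual variance reduces to [r a]. *)
rewrite (bigD1 a)//= ua mulr1 big1 ?addr0.
  have := residual_cov_le1; rewrite -/u -/(r a) => ra.
  by rewrite (_ : 2 = 1 + 1) ?lerD2r//; ring.
move=> i ia; rewrite /r residual_cov0 ?mul0r//.
Qed.

End regression_variance.

Lemma residual_combination (R : realType) (n p : nat) (X : 'M[R]_(n, p))
    (a j : 'I_p) (theta0 : 'I_p -> R) (e : R) (i : 'I_n) :
  theta0 a = 0 ->
  \sum_(k < p) (residual_dir a theta0 k + e * (k == j)%:R) * X i k =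
  (X i a - Xmul X a theta0 i) + e * X i j.
Proof.
move=> ta; under eq_bigr do rewrite mulrDl mulrBl.
rewrite big_split sumrB/= (bigD1 a)//= eqxx mul1r big1 ?addr0; last first.
  by move=> k /negbTE ->; rewrite mul0r.
congr (_ - _ + _).
  rewrite /Xmul; apply: eq_bigr => k _; rewrite /Xminus mxE.
  by case: eqVneq => [->|_]; rewrite ?ta ?mul0r 1?mulrC// mul0r.
rewrite (bigD1 j)//= eqxx mulr1 big1 ?addr0// => k /negbTE ->.
by rewrite mulr0 mul0r.
Qed.

(** * Numerical Chernoff exponent, union bound and the noise event *)

Lemma expR1_ge2 (R : realType) : 2 <= expR 1 :> R.
Proof. by have := expR_ge1Dx (1 : R). Qed.

(* Chernoff at [theta = r / (r + 1)], where [x = r^2 / 2 + r]: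
   [theta x = r^2 / 2 + u + 1] with [u] as below, and the moment generating
   function costs at most [exp u] per row. *)
Lemma chernoff_exponent (R : realType) (n : nat) (r V : R) :
  (0 < n)%N -> 6 <= r -> 0 < V <= 2 ->
  let c := r / (r + 1) / 2 in
  c * V < 1 /\
  (Num.sqrt (1 - c * V))^-1 ^+ n *
    expR (- (c / 2 * (4 * n%:R * (r ^+ 2 / 2 + r)))) <=
  expR (- (n%:R * (r ^+ 2 / 2))) / 2.
Proof.
move=> n0 r6 /andP[V0 V2] c.
have r1 : 0 < r + 1 by lra.
have c0 : 0 <= c by rewrite /c !divr_ge0//; lra.
have cV : c * V <= r / (r + 1).
  rewrite (_ : r / (r + 1) = c * 2); last by rewrite /c; field; lra.
  exact: ler_wpM2l.
have gap : (r + 1)^-1 <= 1 - c * V.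
  rewrite (_ : (r + 1)^-1 = 1 - r / (r + 1)); last by field; lra.
  by rewrite lerD2l lerN2.
have inv0 : 0 < (r + 1)^-1 by rewrite invr_gt0.
split; first by lra.
pose u := r ^+ 2 / (2 * (r + 1)) - 1.
(* Since [2 u = r - 3 + 1 / (r + 1)], the right side is at least [exp (r - 3) >= (r / 3)^3], which
   dominates [r + 1] once [r >= 6]. *)
have ru : r + 1 <= expR (2 * u).
  have -> : 2 * u = (r - 3 + (r + 1)^-1).
    by rewrite /u; field; lra.
  apply: (@le_trans _ _ (expR (r - 3))); last by rewrite ler_expR; lra.
  rewrite (_ : r - 3 = 3 * ((r - 3) / 3)); last by field.
  rewrite expRM_natl.
  have h : r / 3 <= expR ((r - 3) / 3).
    by apply: le_trans (expR_ge1Dx _); lra.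
  apply: (@le_trans _ _ ((r / 3) ^+ 3)); last first.
    by rewrite lerXn2r ?nnegrE ?expR_ge0//; lra.
  rewrite !exprS expr0 mulr1; nra.
have K : (Num.sqrt (1 - c * V))^-1 <= expR u.
  rewrite -sqrtrV; last by lra.
  rewrite -(ger0_norm (expR_ge0 u)) -sqrtr_sqr ler_sqrt ?sqr_ge0//.
  rewrite -expRM_natl.
  apply: le_trans ru.
  by rewrite -[leRHS]invrK lef_pV2// posrE; lra.
have Kn : (Num.sqrt (1 - c * V))^-1 ^+ n <= expR (n%:R * u).
  by rewrite expRM_natl lerXn2r ?nnegrE ?expR_ge0 ?invr_ge0 ?sqrtr_ge0.
apply: (le_trans (ler_wpM2r (expR_ge0 _) Kn)).
rewrite -expRD.
(* The spare [exp (- n)] is at most [1 / 2]; this is the factor that pays for the two signs in the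
   union bound. *)
have -> : n%:R * u + - (c / 2 * (4 * n%:R * (r ^+ 2 / 2 + r))) =
    - (n%:R * (r ^+ 2 / 2)) - n%:R.
  by rewrite /u /c; field; lra.
rewrite expRD ler_wpM2l ?expR_ge0// expRN lef_pV2 ?posrE ?expR_gt0//.
by apply: le_trans (expR1_ge2 R) _; rewrite ler_expR ler1n.
Qed.

Lemma measure_bigsetU_le (d : measure_display) (T : measurableType d)
    (R : realType) (mu : {measure set T -> \bar R}) (I : Type) (s : seq I)
    (F : I -> set T) (x : R) :
  (forall i, measurable (F i)) -> (forall i, mu (F i) <= x%:E)%E ->
  (mu (\big[setU/set0]_(i <- s) F i) <= ((size s)%:R * x)%:E)%E.
Proof.
move=> mF Fx; elim: s => [|i s IH]; first by rewrite big_nil measure0 mul0r.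
rewrite big_cons [size _]/= -natr1 mulrDl mul1r addrC EFinD.
have mU : measurable (\big[setU/set0]_(j <- s) F j).
  exact: bigsetU_measurable.
by apply: (le_trans (measureU2 _ (mF i) mU)); exact: leeD (Fx i) IH.
Qed.

Lemma noise_event (d : measure_display) (Omega : measurableType d)
    (R : realType) (P : probability Omega R) (n p : nat) (Sigma : 'M[R]_p)
    (X : Omega -> 'M[R]_(n, p)) (a : 'I_p) (theta0 : 'I_p -> R) (r : R) :
  (0 < n)%N -> pos_def Sigma -> (forall i, Sigma i i = 1) ->
  gaussian_design P Sigma X -> regression_coef Sigma a theta0 -> 6 <= r ->
  exists A : set Omega, [/\ measurable A,
    (1 - (p%:R * expR (- (n%:R * (r ^+ 2 / 2))))%:E <= P A)%E &
    forall w, A w -> forall j,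
      `|\sum_(i < n) (X w i a - Xmul (X w) a theta0 i) *
                      Xminus (X w) a i j| <= n%:R * (r ^+ 2 / 2 + r)].
Proof.
move=> n0 SigmaP Sigma1 XP theta0P r6.
have ta := proj1 theta0P.
(* The boolean selects [eps + X_j] or [eps - X_j]. The level [y] carries the 4 of polarisation, and
   the event for [j = a] is empty because column [a] of [Xminus] is zero. *)
pose v (jb : 'I_p * bool) k :=
  residual_dir a theta0 k + (-1) ^+ jb.2 * (k == jb.1)%:R.
pose S jb w := \sum_(i < n) (\sum_(k < p) v jb k * X w i k) ^+ 2.
pose y : R := 4 * n%:R * (r ^+ 2 / 2 + r).
pose bad jb := if jb.1 == a then set0 else [set w | y <= S jb w].
have mbad jb : measurable (bad jb).
  rewrite /bad; case: ifP => // _; rewrite -[X in measurable X]setTI.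
  have mS : measurable_fun setT (S jb).
    apply: measurable_sum => i; apply: measurable_funX.
    exact: (measurable_row_combination _ _ _ _ _ _ _ _ XP).
  rewrite (_ : [set w | y <= S jb w] = S jb @^-1` `[y, +oo[).
    exact: mS.
  by apply/seteqP; split => w /=; rewrite in_itv/= andbT.
have Pbad jb : (P (bad jb) <= (expR (- (n%:R * (r ^+ 2 / 2))) / 2)%:E)%E.
  rewrite /bad; case: eqVneq => [_|ja].
    by rewrite measure0 lee_fin divr_ge0 ?expR_ge0.
  have va : v jb a != 0.
    by rewrite /v /residual_dir eqxx ta subr0 [a == _]eq_sym (negbTE ja) mulr0 addr0
      oner_eq0.
  have V0 : 0 < quad_form Sigma (v jb) by apply: (proj2 SigmaP); exists a.
  have V2 : quad_form Sigma (v jb) <= 2 by exact: quad_form_residualD.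
  have c0 : 0 < r / (r + 1) / 2 by rewrite !divr_gt0//; lra.
  have [cV tail] := chernoff_exponent _ _ _ _ n0 r6 (introT andP (conj V0 V2)).
  (* The tail bound takes its parameter as a square, hence the root of the [c] of
     [chernoff_exponent]. *)
  have sc : Num.sqrt (r / (r + 1) / 2) ^+ 2 = r / (r + 1) / 2.
    by rewrite sqr_sqrtr// ltW.
  have := gaussian_combination_tail _ _ _ _ _ _ _ _ XP (v jb)
    (Num.sqrt (r / (r + 1) / 2)) y (ex_intro _ a va) V0.
  rewrite sqrtr_gt0 sc => /(_ c0 cV) /le_trans; apply.
  by rewrite lee_fin.
exists (~` \big[setU/set0]_jb bad jb).
have mU : measurable (\big[setU/set0]_jb bad jb) by exact: bigsetU_measurable.
split; first exact: measurableC.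
  rewrite probability_setC// leeB//.
  have := measure_bigsetU_le _ _ _ P _ (index_enum _) bad _ mbad Pbad.
  rewrite [X in size X]unlock -enumT -cardE card_prod card_ord card_bool natrM -mulrA.
  by rewrite [2%:R * _]mulrC divfK.
move=> w Aw j.
have [->|ja] := eqVneq j a.
  rewrite big1 ?normr0.
    by rewrite mulr_ge0 ?ler0n// addr_ge0 ?divr_ge0 ?sqr_ge0//; lra.
  by move=> i _; rewrite mxE eqxx mulr0.
have good b : S (j, b) w < y.
  rewrite ltNge; apply/negP => Sy; apply: Aw.
  rewrite -bigcup_seq; exists (j, b); first by rewrite /= mem_index_enum.
  by rewrite /bad/= (negbTE ja).
have SE b : S (j, b) w = \sum_(i < n)
    ((X w i a - Xmul (X w) a theta0 i) + (-1) ^+ b * X w i j) ^+ 2.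
  by apply: eq_bigr => i _; rewrite residual_combination.
under eq_bigr do rewrite mxE (negbTE ja).
set N := \sum_(i < n) _.
(* Polarisation: both sums lie in [[0, y)], so their difference is below [y] in absolute value. *)
have N4 : 4 * N = S (j, false) w - S (j, true) w.
  rewrite !SE -sumrB mulr_sumr; apply: eq_bigr => i _.
  by rewrite expr0 expr1; ring.
have S0 b : 0 <= S (j, b) w by apply: sumr_ge0 => i _; exact: sqr_ge0.
have := good false; have := good true; have := S0 false; have := S0 true.
rewrite /y -mulrA => *; rewrite ler_norml; apply/andP; split; lra.
Qed.

Theorem mainTheorem14 (R : realType) (d : measure_display) (Omega : measurableType d)
  (P : probability Omega R) (n p : nat) (Sigma : 'M[R]_p)
  (X : Omega -> 'M[R]_(n, p)) (a : 'I_p) (theta0 : 'I_p -> R)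
  (Elocal : {set 'I_p * 'I_p}) (B : nat) (Delta phi0 t lam mu : R) :
  (0 < n)%N ->
  pos_def Sigma ->
  (forall i, Sigma i i = 1) ->
  gaussian_design P Sigma X ->
  regression_coef Sigma a theta0 ->
  (forall e, e \in Elocal -> (e.1 < e.2)%N) ->
  (0 < B)%N ->
  (forall k, (Dcol_count Elocal a k <= B)%N) ->
  0 < Delta -> 0 < phi0 ->
  lam = 4 * (t + ln p%:R) / n%:R ->
  mu = 4 / B%:R * Num.sqrt (2 / n%:R * (t + ln p%:R)) ->
  2 * n%:R * (3 + 14 / Delta) ^+ 2 <= t ->
  exists A : set Omega, measurable A /\
    ((1 - expR (- t))%:E <= P A)%E /\
    forall w, A w ->
      let S0 := finset (fun j : 'I_p => theta0 j != 0) in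
      compatibility (X w) a S0 Delta phi0 ->
      forall thetahat, is_estimator (X w) a Elocal lam mu thetahat ->
        n%:R^-1 * \sum_(i < n) (Xmul (X w) a (fun j => thetahat j - theta0 j) i) ^+ 2
        + (lam - 3 * B%:R * mu) * l1norm (fun j => thetahat j - theta0 j)
        <= #|S0|%:R * (2 * lam + B%:R * mu) ^+ 2 / phi0 ^+ 2.
Proof.
move=> n0 SigmaP Sigma1 XP theta0P ltE B0 colB D0 phi0P lamE muE tge.
have nn : 0 < n%:R :> R by rewrite ltr0n.
have BB : 0 < B%:R :> R by rewrite ltr0n.
have p0 : (0 < p)%N by apply: leq_ltn_trans (ltn_ord a).
have lnp : 0 <= ln p%:R :> R by rewrite ln_ge0// ler1n.
set r := Num.sqrt (2 / n%:R * (t + ln p%:R)) in muE.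
have D14 : 0 < 14 / Delta by rewrite divr_gt0.
(* The lower bound on [t], with [ln p >= 0], is exactly [r >= 2 (3 + 14 / Delta)] after taking
   roots; this yields both [r >= 6] and the required ratio of [lam] to [B mu]. *)
have rad : (2 * (3 + 14 / Delta)) ^+ 2 <= 2 / n%:R * (t + ln p%:R).
  rewrite mulrAC ler_pdivlMr//.
  rewrite (_ : _ * n%:R = 2 * (2 * n%:R * (3 + 14 / Delta) ^+ 2)); last by ring.
  by rewrite ler_pM2l// (le_trans tge)// lerDl.
have rad0 : 0 <= 2 / n%:R * (t + ln p%:R) by apply: le_trans rad; exact: sqr_ge0.
have r2 : r ^+ 2 = 2 / n%:R * (t + ln p%:R) by rewrite sqr_sqrtr.
have rge : 2 * (3 + 14 / Delta) <= r.
  by rewrite -ler_sqr ?nnegrE ?sqrtr_ge0 ?r2//; lra.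
have r6 : 6 <= r by lra.
have lamr : lam = 2 * r ^+ 2 by rewrite lamE r2; field; rewrite gt_eqF.
have Bmu : B%:R * mu = 4 * r by rewrite muE; field; rewrite gt_eqF.
have [A [mA PA noise]] := noise_event _ _ _ _ _ _ _ _ a theta0 r
  n0 SigmaP Sigma1 XP theta0P r6.
exists A; split => //; split.
  (* The [ln p] in the tuning parameters cancels the factor [p] of the union bound. *)
  move: PA; rewrite (_ : p%:R * _ = expR (- t)) ?EFinB//.
  have -> : n%:R * (r ^+ 2 / 2) = t + ln p%:R by rewrite r2; field; rewrite gt_eqF.
  have pp : 0 < p%:R :> R by rewrite ltr0n.
  by rewrite opprD expRD [expR (- ln _)]expRN lnK ?posrE// mulrCA divff ?mulr1// gt_eqF.
move=> w Aw S0 compat thetahat est.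
apply: oracle_inequality ltE colB _ _ compat est => //.
- by rewrite muE mulr_gt0 ?divr_gt0//; lra.
- rewrite Bmu lamr expr2 (_ : _ * (4 * r) = 2 * (2 * (3 + 14 / Delta) * r)).
    by rewrite ler_pM2l// ler_wpM2r//; lra.
  by ring.
- move=> j; apply: le_trans (noise w Aw j) _; rewrite ler_wpM2l ?ler0n//.
  by rewrite Bmu lamr; lra.
Qed.
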